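(* There exist absolute constants $c, C > 0$ such that for infinitely many positive integers $n$ there is an $n \times n$ Boolean matrix $A$ satisfying all of the following: (1) $A$ has at least $c\, n^{4/3}$ zero-entries; (2) $A$ has no $2 \times 2$ all-zero submatrix; (3) $\operatorname{Cov}(A) \le C \log^4(n)$. (That is, there exist $n \times n$ Boolean matrices $A$ with $\Omega(n^{4/3})$ zero-entries and no $2\times 2$ all-zero submatrices that satisfy $\operatorname{Cov}(A) = O(\log^4(n))$.)
   Context: A Boolean matrix is a matrix with entries in $\{0,1\}$. A submatrix of $A$ is obtained by choosing a set $R$ of rows and a set $S$ of columns (not necessarily consecutive) and restricting $A$ to $R \times S$; it is all-zero (respectively all-one) if all its entries equal $0$ (respectively $1$). In particular, $A$ has no $2 \times 2$ all-zero submatrix if there are no two distinct rows $i \neq i'$ and two distinct columns $j \neq j'$ with $A_{i,j} = A_{i,j'} = A_{i',j} = A_{i',j'} = 0$. The covering number $\operatorname{Cov}(A)$ of a Boolean matrix $A$ is the smallest number of all-one submatrices of $A$ that together cover all the one-entries of $A$ (the submatrices may overlap). The notation $\log^4(n)$ means $(\log n)^4$. *)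

(* Defs.v *)
From mathcomp Require Import all_boot all_order all_algebra.

Set Implicit Arguments.
Unset Strict Implicit.
Unset Printing Implicit Defensive.

(* The submatrix of A with row set R and column set S is encoded by the pair
   (R, S).  Empty R or S is allowed: such a submatrix covers nothing, so it
   does not change the covering number. *)
Definition submx_idx (m n : nat) : finType :=
  ({set 'I_m} * {set 'I_n})%type.

Definition all_zero_submx (m n : nat) (A : 'M[bool]_(m, n))
    (B : submx_idx m n) : bool :=
  [forall i in B.1, forall j in B.2, A i j == false].

Definition all_one_submx (m n : nat) (A : 'M[bool]_(m, n))
    (B : submx_idx m n) : bool :=
  [forall i in B.1, forall j in B.2, A i j == true].

Definition zero_entries (m n : nat) (A : 'M[bool]_(m, n)) :
    {set 'I_m * 'I_n} :=
  [set p | A p.1 p.2 == false].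

Definition has_all_zero_2x2 (m n : nat) (A : 'M[bool]_(m, n)) : bool :=
  [exists B : submx_idx m n,
    [&& #|B.1| == 2, #|B.2| == 2 & all_zero_submx A B]].

Definition one_cover (m n : nat) (A : 'M[bool]_(m, n))
    (F : {set submx_idx m n}) : bool :=
  [forall B in F, all_one_submx A B] &&
  [forall i, forall j,
    A i j ==> [exists B in F, (i \in B.1) && (j \in B.2)]].

(* The family of all all-one submatrices is only the witness that a cover
   exists, as required by arg min; see Cov_attained and Cov_min. *)
Definition Cov (m n : nat) (A : 'M[bool]_(m, n)) : nat :=
  #|[arg min_(F < [set B | all_one_submx A B] | one_cover A F) #|F|]|.

Lemma one_cover_all (m n : nat) (A : 'M[bool]_(m, n)) :
  one_cover A [set B | all_one_submx A B].
Proof.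
apply/andP; split; first by apply/forall_inP => B; rewrite inE.
apply/forallP => i; apply/forallP => j; apply/implyP => Aij.
apply/exists_inP; exists ([set i], [set j]); last by rewrite !inE !eqxx.
rewrite inE; apply/forall_inP => i' /set1P ->.
by apply/forall_inP => j' /set1P ->; rewrite Aij.
Qed.

Lemma Cov_attained (m n : nat) (A : 'M[bool]_(m, n)) :
  exists2 F : {set submx_idx m n}, one_cover A F & #|F| = Cov A.
Proof.
rewrite /Cov; case: arg_minnP => [|F coverF _]; first exact: one_cover_all.
by exists F.
Qed.

Lemma Cov_min (m n : nat) (A : 'M[bool]_(m, n)) (F : {set submx_idx m n}) :
  one_cover A F -> Cov A <= #|F|.
Proof.
move=> coverF; rewrite /Cov; case: arg_minnP => [|G _ minG].
  exact: one_cover_all.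
exact: minG.
Qed.

Lemma has_all_zero_2x2P (m n : nat) (A : 'M[bool]_(m, n)) :
  reflect (exists i i' j j', [/\ i != i', j != j' &
             [/\ A i j = false, A i j' = false,
                 A i' j = false & A i' j' = false]])
          (has_all_zero_2x2 A).
Proof.
apply: (iffP existsP) => [[[R S] /and3P[/cards2P[i [i' [ii' /= ->]]]
    /cards2P[j [j' [jj' /= ->]]] /forall_inP A0]]|].
  have Z x y : x \in [set i; i'] -> y \in [set j; j'] -> A x y = false.
    by move=> xR yS; apply/eqP; have /forall_inP := A0 x xR; apply.
  by exists i, i', j, j'; split=> //; split; apply: Z; rewrite !inE eqxx ?orbT.
move=> [i [i' [j [j' [ii' jj' [Z1 Z2 Z3 Z4]]]]]].
exists ([set i; i'], [set j; j']); rewrite !cards2 ii' jj' /=.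
apply/forall_inP => x /set2P[] ->; apply/forall_inP => y /set2P[] ->;
  exact/eqP.
Qed.

(* Main.v *)
(** The zeros of [A] are the incidences between the points [(x, y)] and the
    lines [y = a x + b] of an integer grid with [x, a < N] and [y, b < 2 N^2],
    where [N = 2^k]: this is the extremal configuration for the
    Szemeredi-Trotter theorem, and two lines share at most one point.
    If [y <> a x + b], then the two sides already differ modulo some
    [q = O(log N)], because a nonzero integer divisible by all of
    [1, ..., 2L] is at least ['C(2L, L) >= 2^L].  Fixing [q] and the residues
    of [x] and [y] modulo [q] thus gives [O(log^3 n)] all-one submatrices that
    cover the ones. *)
Require Import Defs.
From mathcomp Require Import all_boot all_order all_algebra.
From mathcomp Require Import reals exp.
From mathcomp Require Import zify ring.

Set Implicit Arguments.
Unset Strict Implicit.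
Unset Printing Implicit Defensive.

Import Order.TTheory GRing.Theory Num.Theory.

(** [D] stands for any common multiple of [1, ..., n]. The factor [k] is what lets the induction on
    [k] close. *)
Lemma mul_bin_dvd (D n k : nat) :
  (forall q, 0 < q <= n -> q %| D) -> 0 < k <= n -> k * 'C(n, k) %| D.
Proof.
elim: k n => // k IHk n Ddiv /andP[_ lt_kn].
have [->|k_gt0] := posnP k.
  by rewrite bin1 mul1n Ddiv // leqnn andbT; lia.
case: n => // n in Ddiv lt_kn *.
have/dvdnP[u Du]: k * 'C(n, k) %| D.
  by apply: IHk => [q q_n|]; [apply: Ddiv|]; lia.
have/dvdnP[v Dv]: k * 'C(n.+1, k) %| D by apply: IHk => //; lia.
(* Leibniz's harmonic triangle:
   1/(k C(n,k)) - 1/(k C(n+1,k)) = 1/((k+1) C(n+1,k+1)). *)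
have diag := mul_bin_diag n.+1 k.
have down := mul_bin_down n.+1 k.
apply/dvdnP; exists (u - v).
have e1 : (n.+1 - k) * D = v * k * (n.+1 * 'C(n, k)) by rewrite down {1}Dv; ring.
rewrite -diag.
have e2 : n.+1 * D = u * k * (n.+1 * 'C(n, k)) by rewrite {1}Du; ring.
have e3 : k * D = (u - v) * k * (n.+1 * 'C(n, k)).
  rewrite !mulnBl -e1 -e2 -mulnBl; congr (_ * _); lia.
by apply/eqP; rewrite -(eqn_pmul2l k_gt0) e3; apply/eqP; ring.
Qed.

(** Pascal's rule and symmetry split the next central coefficient into two equal terms, each at
    least ['C(2L, L)]. *)
Lemma exp2_le_central_bin (L : nat) : 2 ^ L <= 'C(L.*2, L).
Proof.
elim: L => // L IHL; rewrite doubleS binS expnS mul2n -addnn.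
have -> : 'C(L.*2.+1, L.+1) = 'C(L.*2.+1, L).
  by rewrite -bin_sub; [congr 'C(_, _)|]; lia.
have le_bin : 'C(L.*2, L) <= 'C(L.*2.+1, L).
  by case: (L) => [|l]; [rewrite !bin0|rewrite [leqRHS]binS leq_addr].
by rewrite leq_add // (leq_trans IHL).
Qed.

Lemma modn_separated (L s t : nat) : s < 2 ^ L -> t < 2 ^ L -> s != t ->
  exists2 q, 0 < q <= L.*2 & s %% q != t %% q.
Proof.
wlog lt_st : s t / s < t => [W sL tL|].
  rewrite neq_ltn => /orP[lt|lt].
    by apply: W => //; rewrite neq_ltn lt.
  have [|q q_L ne] := W _ _ lt tL sL; first by rewrite neq_ltn lt.
  by exists q; rewrite // eq_sym.
move=> _ tL _; have [L0|L_gt0] := posnP L; first by move: tL; rewrite L0; lia.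
have [/hasP[q]|/hasPn noq] :=
    boolP (has (fun q => s %% q != t %% q) (iota 1 L.*2)).
  by rewrite mem_iota => q_L ne; exists q => //; lia.
have: L * 'C(L.*2, L) %| t - s.
  apply: mul_bin_dvd => [q q_L|]; last by lia.
  rewrite -eqn_mod_dvd; last exact: ltnW.
  by rewrite eq_sym -[_ == _]negbK; apply: noq; rewrite mem_iota; lia.
move=> /(@dvdn_leq _ _ _); rewrite subn_gt0 => /(_ lt_st) le_ts.
have := leq_trans (leq_pmull _ L_gt0) le_ts.
by have := exp2_le_central_bin L; lia.
Qed.

(* The point or line with index [i < N * M] has coordinates
   [(i %/ M, i %% M)]. *)
Definition nonincidence_mx (N M : nat) : 'M[bool]_(N * M) :=
  \matrix_(i, j) (i %% M != (j %/ M) * (i %/ M) + j %% M).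

Lemma nonincidence_no_zero_2x2 (N M : nat) :
  ~~ has_all_zero_2x2 (nonincidence_mx N M).
Proof.
apply/has_all_zero_2x2P => -[i [i' [j [j' [ii' jj' []]]]]].
rewrite !mxE => /negbFE/eqP e1 /negbFE/eqP e2 /negbFE/eqP e3 /negbFE/eqP e4.
have coord (u v : 'I_(N * M)) : u %/ M = v %/ M -> u %% M = v %% M -> u = v.
  by move=> d m; apply: val_inj; rewrite /= (divn_eq u M) (divn_eq v M) d m.
have [ex|nx] := eqVneq (i %/ M) (i' %/ M).
  by case/eqP: ii'; apply: coord => //; rewrite e1 e3 ex.
(* Eliminating [y] and [b] from the four equations leaves [(a - a')(x - x') = 0] over the
   integers. *)
have ea : j %/ M = j' %/ M.
  move: e1 e2 e3 e4 nx; move: (_ %/ _) (_ %% _) (_ %/ _) (_ %% _) => a b x y.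
  move: (_ %/ _) (_ %% _) (_ %/ _) (_ %% _) => *; nia.
by case/eqP: jj'; apply: coord => //; move: e1; rewrite e2 ea => /addnI.
Qed.

(** Each choice of [x, a < N] and [b < H] gives the incidence of [(x, a x + b)] with the line
    [(a, b)]; the hypothesis keeps [a x + b] below [M]. *)
Lemma nonincidence_zero_entries (N M H : nat) : N * N + H <= M ->
  N * N * H <= #|zero_entries (nonincidence_mx N M)|.
Proof.
move=> leM.
have idx_lt (u v : nat) : u < N -> v < M -> u * M + v < N * M by nia.
have y_lt (x a : 'I_N) (b : 'I_H) : a * x + b < M.
  by have := ltn_ord x; have := ltn_ord a; have := ltn_ord b; nia.
have b_lt (b : 'I_H) : b < M by have := ltn_ord b; lia.
pose f (t : 'I_N * 'I_N * 'I_H) : 'I_(N * M) * 'I_(N * M) :=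
  (Ordinal (idx_lt _ _ (ltn_ord t.1.1) (y_lt t.1.1 t.1.2 t.2)),
   Ordinal (idx_lt _ _ (ltn_ord t.1.2) (b_lt t.2))).
have divE (u v : nat) : v < M -> (u * M + v) %/ M = u.
  by move=> ltv; rewrite divnMDl ?divn_small ?addn0 //; lia.
have modE (u v : nat) : v < M -> (u * M + v) %% M = v.
  by move=> ltv; rewrite modnMDl modn_small.
have f_inj : injective f.
  move=> [[x a] b] [[x' a'] b'] [/= e1 e2].
  have := congr1 (divn^~ M) e1; have := congr1 (divn^~ M) e2.
  have := congr1 (modn^~ M) e2; rewrite /= !divE ?modE //.
  by move=> /val_inj-> /val_inj-> /val_inj->.
have -> : N * N * H = #|[set: 'I_N * 'I_N * 'I_H]|.
  by rewrite cardsT !card_prod !card_ord.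
rewrite -(card_imset _ f_inj); apply/subset_leq_card/subsetP => _ /imsetP[t _ ->].
by rewrite inE mxE /= !divE ?modE // eqxx.
Qed.

Lemma nonincidence_Cov (N M L : nat) : N * N + M <= 2 ^ L ->
  Cov (nonincidence_mx N M) <= L.*2.+1 ^ 3.
Proof.
move=> leL; set K := L.*2.+1.
(* Here [q] is the modulus and [u], [v] are the residues of [x] and [y]. Modulo [q], [a x + b] is
   [a u + b], so the column set can be chosen without knowing [x]. *)
pose B (t : 'I_K * 'I_K * 'I_K) : submx_idx (N * M) (N * M) :=
  let: (q, u, v) := t in
  ([set i : 'I__ | ((i %/ M) %% q == u) && ((i %% M) %% q == v)],
   [set j : 'I__ | ((j %/ M) * u + j %% M) %% q != v]).
have cardB : #|B @: [set: 'I_K * 'I_K * 'I_K]| <= K ^ 3.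
  apply: leq_trans (leq_imset_card _ _) _.
  by rewrite cardsT !card_prod !card_ord; lia.
apply: leq_trans (Cov_min _) cardB; apply/andP; split.
  apply/forall_inP => _ /imsetP[[[q u] v] _ ->].
  apply/forall_inP => i; rewrite inE => /andP[/eqP xu /eqP yv].
  apply/forall_inP => j; rewrite inE mxE => /= ne; rewrite eqb_id.
  by apply: contraNneq ne => e; rewrite -yv e -xu -modnDml modnMmr modnDml.
apply/forallP => i; apply/forallP => j; apply/implyP; rewrite mxE => ne.
have M_gt0 : 0 < M by have := ltn_ord i; nia.
have lt_mod (l : 'I_(N * M)) : l %% M < M by rewrite ltn_mod.
have lt_div (l : 'I_(N * M)) : l %/ M < N by rewrite ltn_divLR.
have [||q /andP[q_gt0 qK] neq] := modn_separated (L := L) _ _ ne.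
- by have := lt_mod i; lia.
- apply: leq_trans leL; rewrite -addnS leq_add //.
  by rewrite leq_mul // ltnW.
have ltK s : s %% q < K by apply: leq_trans (ltn_pmod s q_gt0) _; lia.
apply/exists_inP.
exists (B (Ordinal (qK : q < K),
           Ordinal (ltK (i %/ M)), Ordinal (ltK (i %% M)))).
  by apply: imset_f; rewrite inE.
by rewrite !inE /= !eqxx /= -modnDml modnMmr modnDml eq_sym.
Qed.

Local Open Scope ring_scope.

Theorem theorem2p1 (R : realType) :
  exists c C : R, [/\ 0 < c, 0 < C &
    forall N : nat, exists n : nat, (N < n)%N /\
      exists A : 'M[bool]_n,
        [/\ c * n%:R `^ (4 / 3) <= #|zero_entries A|%:R,
            ~~ has_all_zero_2x2 A &
            (Cov A)%:R <= C * ln (n%:R : R) ^+ 4]].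
Proof.
have ln2_gt0 : 0 < ln (2 : R) by rewrite ln_gt0 // ltr1n.
(* With [n = 2 m^3 = 2^(3k+1)]: [n <= (2m)^3] costs the factor [2^4 = 16], and the cover has size at
   most [27 (3k+1)^4], where [3k+1 = ln n / ln 2]. *)
exists (16^-1), (27 / ln 2 ^+ 4); split=> [||N].
- by rewrite invr_gt0 ltr0n.
- by rewrite divr_gt0 ?exprn_gt0 ?ltr0n.
pose k := N.+1; pose m := (2 ^ k)%N.
have mm : (m * m = 2 ^ (k + k))%N by rewrite expnD.
have n2 : (m * (2 * (m * m)) = 2 ^ (3 * k).+1)%N.
  by rewrite mm -expnS -expnD; congr (2 ^ _)%N; lia.
exists (m * (2 * (m * m)))%N; split.
  by rewrite n2; apply: leq_trans (ltn_expl _ _) => //; lia.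
exists (nonincidence_mx m (2 * (m * m))); split.
- have zeros : (m ^ 4 <= #|zero_entries (nonincidence_mx m (2 * (m * m)))|)%N.
    apply: leq_trans (nonincidence_zero_entries (H := m * m) _); last by lia.
    by rewrite !expnS expn0; lia.
  apply: le_trans (_ : (m ^ 4)%:R <= _); last by rewrite ler_nat.
  rewrite mulrC ler_pdivrMr ?ltr0n //.
  (* Monotonicity of the power [4/3] then leaves only [2 m^3 <= (2m)^3]. *)
  have -> : (m ^ 4)%:R * 16 = (((2 * m)%:R : R) `^ 3) `^ (4 / 3).
    rewrite -powRrM (_ : 3 * (4 / 3) = 4%:R); last by field.
    by rewrite powR_mulrn ?ler0n // !(natrX, natrM); ring.
  apply: ge0_ler_powR; rewrite ?nnegrE ?ler0n ?powR_ge0 //.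
    by rewrite divr_ge0 ?ler0n.
  by rewrite powR_mulrn ?ler0n // -natrX ler_nat !expnS expn0; lia.
- exact: nonincidence_no_zero_2x2.
have cov : (Cov (nonincidence_mx m (2 * (m * m))) <= 27 * (3 * k).+1 ^ 4)%N.
  (* This [L] works since [m^2 + 2 m^2 <= 4 m^2 = 2^(2k+2)]; then [2L + 1 = 4k + 5 <= 3 (3k+1)]
     because [k >= 1]. *)
  apply: leq_trans (nonincidence_Cov (L := (k + k).+2) _) _.
    by rewrite mm !expnS; lia.
  apply: leq_trans (_ : (3 * (3 * k).+1) ^ 3 <= _)%N.
    by rewrite leq_exp2r // /k; lia.
  by rewrite expnMn leq_mul // leq_exp2l //; lia.
apply: le_trans (_ : (27 * (3 * k).+1 ^ 4)%:R <= _); first by rewrite ler_nat.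
rewrite n2 natrX lnXn ?ltr0n // -[ln 2 *+ _]mulr_natl exprMn mulrCA divfK.
  by rewrite natrM natrX mulrC.
by rewrite expf_neq0 ?gt_eqF.
Qed.
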